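(* Let $r\ge 3$ and let $\mathcal{H}$ be an $r$-uniform $r$-partite linear hypergraph which contains no rainbow cycles of length three or four. Then $\mathcal{H}$ is $\mathcal{G}_r(8r-13,8)$-free.
   Context: A hypergraph is linear if any two distinct edges share at most one vertex. An $r$-uniform hypergraph is $r$-partite if its vertex set is partitioned into $r$ parts $V_1,\dots,V_r$ such that every edge contains exactly one vertex of each part. A cycle of length $k$ is a sequence $v_1,A_1,\dots,v_k,A_k,v_1$ of distinct vertices and distinct edges with $v_i,v_{i+1}\in A_i$ ($1\le i\le k-1$) and $v_k,v_1\in A_k$; it is a rainbow $k$-cycle if $v_1,\dots,v_k$ lie in pairwise different parts. An $r$-uniform hypergraph is $\mathcal{G}_r(v,e)$-free if the union of any $e$ distinct edges has at least $v+1$ vertices. *)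

(* Defs.v *)
From mathcomp Require Import all_boot.

Set Implicit Arguments.
Unset Strict Implicit.
Unset Printing Implicit Defensive.

(* A hypergraph on the finite vertex type V is its edge set E : {set {set V}}. *)
Section Hypergraph.

Variables (V : finType) (E : {set {set V}}).

Definition uniform (r : nat) : Prop := {in E, forall A : {set V}, #|A| = r}.

Definition linear_hypergraph : Prop :=
  {in E &, forall A B : {set V}, A != B -> #|A :&: B| <= 1}.

(* A partition of V into r parts is encoded by the map c sending a vertex to
   the index of its part; the parts are the fibres of c. *)
Definition partite (r : nat) (c : V -> 'I_r) : Prop :=
  {in E, forall (A : {set V}) (i : 'I_r), #|[set x in A | c x == i]| = 1}.

(* ordS is the cyclic successor on 'I_k, so the last edge A_k joins v_k to
   v_1. *)
Definition is_cycle (k : nat) (v : 'I_k -> V) (A : 'I_k -> {set V}) : Prop :=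
  [/\ injective v, injective A, forall i, A i \in E
    & forall i, v i \in A i /\ v (ordS i) \in A i].

Definition has_rainbow_cycle (r : nat) (c : V -> 'I_r) (k : nat) : Prop :=
  exists (v : 'I_k -> V) (A : 'I_k -> {set V}),
    is_cycle v A /\ injective (fun i => c (v i)).

(* The family G_r(n, e) of the r-uniform hypergraphs with e edges and at most
   n vertices; r enters only through the uniformity of E. *)
Definition G_free (n e : nat) : Prop :=
  forall F : {set {set V}}, F \subset E -> #|F| = e -> n.+1 <= #|cover F|.

End Hypergraph.

(* Main.v *)
(* Suppose 8 edges cover at most 8r - 13 vertices. Choose for every covered
   vertex v one of these edges, root v, and join root v to the other edges
   through v. By linearity this is a graph on the 8 edges with
   8r - (number of covered vertices) >= 13 links; colour a link by the part of
   its vertex. Taking stars instead of cliques at the vertices keeps the graph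
   triangle-free, and every 4-cycle of it is a genuine 4-cycle of the
   hypergraph, hence has two opposite links of the same colour while adjacent
   ones differ. This excludes K_{2,4}. Without K_{2,4}, a triangle-free graph
   with 8 vertices and 13 edges has a vertex v of degree 4 whose three
   non-neighbours are pairwise non-adjacent and miss distinct neighbours of v:
   it is the cube with one long diagonal, which admits no such colouring. *)
Require Import Defs.
From mathcomp Require Import all_boot.
From mathcomp Require Import zify.

Set Implicit Arguments.
Unset Strict Implicit.
Unset Printing Implicit Defensive.

(** * Triangle-free graphs with coloured 4-cycles *)

Section QuadGraph.

Variables (T : finType) (C : eqType) (e : rel T) (col : T -> T -> C).
Hypothesis e_sym : symmetric e.
Hypothesis colC : forall x y, col x y = col y x.
Hypothesis triangle_free : forall x y z, e x y -> e y z -> ~~ e x z.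
Hypothesis quad_col : forall x y z t,
  e x y -> e y z -> e z t -> e t x -> x != z -> y != t ->
  col x y <> col y z /\ (col x y = col z t \/ col y z = col t x).

Let N x := [set y | e x y].

Lemma e_irr x : e x x = false.
Proof. by apply/negP => exx; have := triangle_free exx exx; rewrite exx. Qed.

(** This is [quad_col] read from each of the four corners of the cycle x z y t, arranged for two
    vertices x, y with common neighbours z, t. *)
Lemma common_pair_col x y z t : x != y -> z != t ->
  e x z -> e y z -> e x t -> e y t ->
  [/\ col x z <> col y z, col x t <> col y t,
      col x z <> col x t, col y z <> col y t
    & col x z = col y t \/ col x t = col y z].
Proof.
move=> xy zt xz yz xt yt.
have zx : e z x by rewrite e_sym.
have zy : e z y by rewrite e_sym.
have tx : e t x by rewrite e_sym.
have ty : e t y by rewrite e_sym.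
have yx : y != x by rewrite eq_sym.
have tz : t != z by rewrite eq_sym.
have [h1 h2] := quad_col xz zy yt tx xy zt.
have [h3 _] := quad_col zy yt tx xz zt yx.
have [h4 _] := quad_col yt tx xz zy yx tz.
have [h5 _] := quad_col tx xz zy yt tz xy.
rewrite !(colC z, colC t) in h1 h2 h3 h4 h5 *; split; try congruence.
by case: h2 => ->; [left | right].
Qed.

Lemma card_gt3P (A : {set T}) : 3 < #|A| -> exists a b c d,
  [/\ uniq [:: a; b; c; d], a \in A, b \in A, c \in A & d \in A].
Proof.
rewrite cardE; have := enum_uniq A; have := mem_enum A.
case: (enum A) => [|a [|b [|c [|d s]]]] //= memA uA _.
exists a, b, c, d; split; rewrite -?memA ?inE ?eqxx ?orbT //.
move: uA; rewrite /= !inE !negb_or -!andbA.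
by case/and5P=> -> -> -> _ /and5P[-> -> _ -> _].
Qed.

(* On two vertices x, y with common neighbours z_i, orient i -> j when
   col x z_i = col y z_j: a tournament with all out-degrees at most 1. *)
Lemma card_common x y : x != y -> #|N x :&: N y| <= 3.
Proof.
move=> xy; rewrite leqNgt; apply/negP => /card_gt3P[z1 [z2 [z3 [z4]]]].
rewrite /= !inE !negb_or andbT => -[/and3P[/and3P[n12 n13 n14] /andP[n23 n24] n34]].
move=> /andP[x1 y1] /andP[x2 y2] /andP[x3 y3] /andP[x4 y4].
have [? ? ? ? h12] := common_pair_col xy n12 x1 y1 x2 y2.
have [? ? ? ? h13] := common_pair_col xy n13 x1 y1 x3 y3.
have [? ? ? ? h14] := common_pair_col xy n14 x1 y1 x4 y4.
have [? ? ? ? h23] := common_pair_col xy n23 x2 y2 x3 y3.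
have [? ? ? ? h24] := common_pair_col xy n24 x2 y2 x4 y4.
have [? ? ? ? h34] := common_pair_col xy n34 x3 y3 x4 y4.
case: h12 => ?; case: h13 => ?; try congruence;
case: h14 => ?; try congruence; case: h23 => ?; try congruence;
case: h24 => ?; try congruence; case: h34 => ?; congruence.
Qed.

Lemma common_ge4 x y (A : {set T}) :
  A \subset N x -> A \subset N y -> 3 < #|A| -> x = y.
Proof.
move=> Ax Ay A4; apply/eqP/negPn/negP => /card_common.
by rewrite leqNgt => /negP[]; apply: leq_trans A4 (subset_leq_card _); rewrite subsetI Ax.
Qed.

(** * Degree counts around a vertex *)

Lemma card_adj (x : T) (A : {set T}) : #|N x :&: A| = \sum_(y in A) e x y.
Proof.
rewrite -sum1_card big_mkcond [RHS]big_mkcond; apply: eq_bigr => y _.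
by rewrite !inE; case: (e x y); case: (y \in A).
Qed.

(** Without triangles the neighbours of v are pairwise non-adjacent, so apart from v they only see
    [W]. The edges between [N v] and [W] are counted from both ends, hence the doubling. *)
Lemma sum_deg v (W := [set w | (w != v) && ~~ e v w]) :
  \sum_x #|N x| = (#|N v| + \sum_(w in W) #|N w :&: N v|).*2
                  + \sum_(w in W) #|N w :&: W|.
Proof.
rewrite (bigID (mem (N v))) /= [X in _ + X](bigD1 v) ?inE ?e_irr //=.
have -> : \sum_(i in N v) #|N i| = #|N v| + \sum_(w in W) #|N w :&: N v|.
  transitivity (\sum_(i in N v) (1 + #|N i :&: W|)).
    apply: eq_bigr => i; rewrite inE => vi.
    rewrite [#|N i|](cardsD1 v) inE e_sym vi; congr (1 + #|pred_of_set _|).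
    apply/setP => w; rewrite !inE andbC; case iw: (e i w) => //=.
    by rewrite (triangle_free vi iw) andbT.
  rewrite big_split /= sum1_card; congr (_ + _).
  under eq_bigr do rewrite card_adj.
  rewrite exchange_big; apply: eq_bigr => w _; rewrite card_adj.
  by apply: eq_bigr => i _; rewrite e_sym.
have -> : \sum_(i | (i \notin N v) && (i != v)) #|N i| =
  \sum_(w in W) #|N w :&: N v| + \sum_(w in W) #|N w :&: W|.
  rewrite -big_split /=; apply: eq_big => [i|i]; rewrite !inE 1?andbC //.
  case/andP=> iv vi; rewrite -(cardsID (N v) (N i)); congr (_ + #|pred_of_set _|).
  apply/setP => w; rewrite !inE andbC; case iw: (e i w) => //=.
  by case: eqP => //= wv; move: iw; rewrite wv e_sym (negbTE vi).
lia.
Qed.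

Lemma cards3E (A : {set T}) : #|A| = 3 ->
  exists a b c, [/\ a != b, a != c, b != c & A = [set a; b; c]].
Proof.
move=> A3; have: 0 < #|A| by rewrite A3.
move=> /card_gt0P[a aA].
have: #|A :\ a| == 2 by move: A3; rewrite (cardsD1 a A) aA add1n => -[->].
move=> /cards2P[b [c [bc DA]]]; exists a, b, c.
have: b \in A :\ a by rewrite DA !inE eqxx.
have: c \in A :\ a by rewrite DA !inE eqxx orbT.
rewrite !inE => /andP[ca _] /andP[ba _]; split=> //; rewrite 1?eq_sym //.
by rewrite -setUA -DA setD1K.
Qed.

Lemma big_set3 (A : {set T}) (F : T -> nat) a b c :
  a != b -> a != c -> b != c -> A = [set a; b; c] ->
  \sum_(x in A) F x = F a + F b + F c.
Proof.
move=> ab ac bc ->; rewrite -setUA big_setU1 ?inE ?negb_or ?ab //=.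
by rewrite big_setU1 ?inE //= big_set1 addnA.
Qed.

Lemma disjoint_nbrs v x y : e x y -> #|N x :&: N v| + #|N y :&: N v| <= #|N v|.
Proof.
move=> xy; rewrite -cardsUI [X in _ + #|pred_of_set X|](_ : _ = set0) ?cards0 ?addn0.
  by rewrite subset_leq_card // -setIUl subsetIr.
apply/setP => z; rewrite !inE; case xz: (e x z) => //=.
by move: (xy); rewrite e_sym => yx; rewrite (negbTE (triangle_free yx xz)) andbF.
Qed.

(** Having no neighbour in common with y, both x and z must see exactly the three neighbours of v
    that y misses. Together with y these are four common neighbours of x and z. *)
Lemma no_path v x y z : #|N v| = 4 -> ~~ e v y -> x != z -> e x y -> e y z ->
  #|N x :&: N v| = 3 -> #|N y :&: N v| = 1 -> #|N z :&: N v| = 3 -> False.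
Proof.
move=> v4 vy xz xy yz nx ny nz; pose D := N v :\: N y.
have D3 : #|D| = 3 by rewrite cardsD v4 setIC ny.
have sub w : e w y -> #|N w :&: N v| = 3 -> y |: D \subset N w.
  move=> wy nw; suff <- : N w :&: N v = D by rewrite subUset sub1set inE wy subsetIl.
  apply/eqP; rewrite eqEcard nw D3 leqnn andbT; apply/subsetP => u.
  rewrite !inE => /andP[wu ->]; rewrite andbT; apply: contraL wu.
  exact: triangle_free.
case/eqP: xz; apply: (@common_ge4 x z (y |: D)).
- exact: sub.
- by apply: sub => //; rewrite e_sym.
- by rewrite cardsU1 !inE (negbTE vy) andbF D3.
Qed.

(* Here v, x, y, z and the neighbours of v span the cube plus a long diagonal. *)
Lemma no_cube_diag v x y z : #|N v| = 4 -> uniq [:: v; x; y; z] ->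
  #|N x :&: N v| = 3 -> #|N y :&: N v| = 3 -> #|N z :&: N v| = 3 -> False.
Proof.
move=> v4 uv nx ny nz.
have miss w : #|N w :&: N v| = 3 -> exists2 t, v != w -> e v t &
    forall s, e v s -> s != t -> e w s.
  move=> nw; have /eqP/cards1P[t tE] : #|N v :\: N w| = 1.
    by rewrite cardsD v4 setIC nw.
  have := set11 t; rewrite -tE !inE => /andP[wt vt].
  exists t => // s vs; apply: contraNT => ws.
  by have := in_set1 s t; rewrite -tE !inE ws vs /= => <-.
have [t1 vt1 x_adj] := miss x nx; have [t2 vt2 y_adj] := miss y ny.
have [t3 vt3 z_adj] := miss z nz.
(* Vertices of [D] are seen by v, x, y and z alike, so two of them would have four common
   neighbours. Hence t1, t2, t3 make up at least three of the four neighbours of v and are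
   distinct. *)
pose D := N v :\: [set t1; t2; t3].
have D1 : #|D| <= 1.
  apply/card_le1_eqP => s s'; rewrite !inE !negb_or -!andbA.
  move=> /and4P[s1 s2 s3 vs] /and4P[s1' s2' s3' vs'].
  apply: (@common_ge4 _ _ [set u in [:: v; x; y; z]]).
  - apply/subsetP => u; rewrite !inE => /or4P[]/eqP->; rewrite e_sym; auto.
  - apply/subsetP => u; rewrite !inE => /or4P[]/eqP->; rewrite e_sym; auto.
  - by rewrite cardsE (card_uniqP uv).
have := subset_leq_card (subsetIr (N v) [set t1; t2; t3]).
have := cardsID [set t1; t2; t3] (N v); rewrite -/D v4 => DE t_ge.
have t3_gt : 2 < #|[set t1; t2; t3]| by lia.
have t_le : #|[set t1; t2; t3]| <= 3.
  by rewrite -setUA cardsU1 cards2; case: (t1 \notin _); case: (t2 != t3).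
have [t0] : exists t0, t0 \in D by apply/card_gt0P; lia.
rewrite !inE !negb_or -!andbA => /and4P[n01 n02 n03 vt0].
have n12 : t1 != t2.
  by apply: contraTN t3_gt => /eqP->; rewrite setUid cards2; case: (_ != _).
have n13 : t1 != t3.
  by apply: contraTN t3_gt => /eqP->; rewrite setUAC setUid cards2; case: (_ != _).
have n23 : t2 != t3.
  by apply: contraTN t3_gt => /eqP->; rewrite -setUA setUid cards2; case: (_ != _).
have [vx vy vz xy] : [/\ v != x, v != y, v != z & x != y].
  by move: uv; rewrite /= !inE !negb_or -!andbA => /and5P[-> -> -> -> _].
have {vt1 vt2 vt3} [vt1 vt2 vt3] := And3 (vt1 vx) (vt2 vy) (vt3 vz).
have n21 : t2 != t1 by rewrite eq_sym.
have n31 : t3 != t1 by rewrite eq_sym.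
have n32 : t3 != t2 by rewrite eq_sym.
(* On three common neighbours the tournament is a 3-cycle: the colours at x on t0, t2, t3 are those
   at v, cyclically shifted, and likewise at y on t0, t1, t3. None of the four combinations fits the
   cycle x t0 y t3, since the cycle v t1 z t2 makes [col v t1] and [col v t2] differ. *)
have [? ? ? ? h1] :=
  common_pair_col vx n02 vt0 (x_adj _ vt0 n01) vt2 (x_adj _ vt2 n21).
have [? ? ? ? h2] :=
  common_pair_col vx n03 vt0 (x_adj _ vt0 n01) vt3 (x_adj _ vt3 n31).
have [? ? ? ? h3] :=
  common_pair_col vx n23 vt2 (x_adj _ vt2 n21) vt3 (x_adj _ vt3 n31).
have [? ? ? ? h4] :=
  common_pair_col vy n01 vt0 (y_adj _ vt0 n02) vt1 (y_adj _ vt1 n12).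
have [? ? ? ? h5] :=
  common_pair_col vy n03 vt0 (y_adj _ vt0 n02) vt3 (y_adj _ vt3 n32).
have [? ? ? ? h6] :=
  common_pair_col vy n13 vt1 (y_adj _ vt1 n12) vt3 (y_adj _ vt3 n32).
have [? ? ? ? h7] :=
  common_pair_col xy n03 (x_adj _ vt0 n01) (y_adj _ vt0 n02) (x_adj _ vt3 n31) (y_adj _ vt3 n32).
have [? ? ? ? _] :=
  common_pair_col vz n12 vt1 (z_adj _ vt1 n13) vt2 (z_adj _ vt2 n23).
case: h1 => ?; case: h2 => ?; try congruence; case: h3 => ?; try congruence;
case: h4 => ?; case: h5 => ?; try congruence; case: h6 => ?; try congruence;
case: h7 => ?; congruence.
Qed.

Lemma sum_deg_lt26 : #|T| = 8 -> \sum_x #|N x| < 26.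
Proof.
move=> T8; rewrite ltnNge; apply/negP => big.
have [v d4] : exists v, 3 < #|N v|.
  apply/existsP; apply: contraLR big; rewrite negb_exists -ltnNge => /forallP small.
  apply: (@leq_ltn_trans (\sum_(x : T) 3)); last by rewrite sum_nat_const T8.
  by apply: leq_sum => x _; rewrite leqNgt.
pose W := [set w | (w != v) && ~~ e v w].
have cW : #|N v| + #|W| = 7.
  have := cardsC (N v); rewrite T8 (cardsD1 v (~: _)) !inE e_irr.
  have -> : ~: N v :\ v = W by apply/setP => w; rewrite !inE.
  lia.
have nW w : w \in W -> #|N w :&: N v| <= 3.
  by rewrite !inE => /andP[wv _]; apply: card_common.
have mW w : w \in W -> #|N w :&: W| <= #|W|.-1.
  move=> wW; rewrite (cardsD1 w W) wW /=; apply/subset_leq_card/subsetP => u.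
  rewrite !inE => /andP[wu ->]; rewrite andbT; apply: contraTN wu => /eqP->.
  by rewrite e_irr.
move: big; rewrite (sum_deg v) -/W => big.
have sn : \sum_(w in W) #|N w :&: N v| <= #|W| * 3.
  by rewrite -sum_nat_const; apply: leq_sum.
have sm : \sum_(w in W) #|N w :&: W| <= #|W| * #|W|.-1.
  by rewrite -sum_nat_const; apply: leq_sum.
(* For [#|W|] equal to 0, 1, 2 the bounds allow a degree sum of at most 14, 18, 24; larger [W] would
   leave v fewer than 4 neighbours. *)
have W3 : #|W| = 3.
  by move: cW sn sm; case: (#|W|) => [|[|[|[|k]]]] //=; lia.
have {d4 sn sm} v4 : #|N v| = 4 by lia.
have [x [y [z [xy xz yz WE]]]] := cards3E W3.
have [xW yW zW] : [/\ x \in W, y \in W & z \in W].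
  by rewrite WE !inE !eqxx ?orbT.
have [nx ny nz] := And3 (nW x xW) (nW y yW) (nW z zW).
move: big; rewrite !(big_set3 _ xy xz yz WE).
rewrite ![#|_ :&: W|]card_adj !(big_set3 _ xy xz yz WE) !e_irr.
rewrite (e_sym y x) (e_sym z x) (e_sym z y).
have dxy := @disjoint_nbrs v x y; have dxz := @disjoint_nbrs v x z.
have dyz := @disjoint_nbrs v y z; rewrite v4 in dxy dxz dyz *.
move: xW yW zW; rewrite !inE => /andP[xv vx] /andP[yv vy] /andP[zv vz].
have px := @no_path v y x z v4 vx yz; have py := @no_path v x y z v4 vy xz.
have pz := @no_path v x z y v4 vz xy.
rewrite (e_sym y x) in px; rewrite (e_sym z y) in pz.
have indep := @no_cube_diag v x y z v4 _.
rewrite /= !inE !negb_or xy xz yz !(eq_sym v) xv yv zv in indep.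
have tri : ~~ [&& e x y, e y z & e x z].
  by apply/and3P => -[xy' yz']; apply/negP; apply: triangle_free xy' yz'.
move: nx ny nz dxy dxz dyz px py pz indep tri.
move: #|N x :&: N v| #|N y :&: N v| #|N z :&: N v| => a b c.
(* No edge inside [W] forces a = b = c = 3, excluded by [indep]. One edge gives at most 2(4 + 4 + 3)
   + 2 = 24. Two edges force 1 at the middle vertex and 3 at the ends, excluded by [px], [py], [pz];
   three edges contradict [tri]. *)
case: (e x y); case: (e x z); case: (e y z) => //=; lia.
Qed.

End QuadGraph.

(** * Short cycles in a linear partite hypergraph *)

Section StarGraph.

Variables (r : nat) (V : finType) (E : {set {set V}}) (c : V -> 'I_r).
Hypothesis hpart : partite E c.
Hypothesis hlin : linear_hypergraph E.

Lemma linear_meet A B u v : A \in E -> B \in E -> A != B ->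
  u \in A -> u \in B -> v \in A -> v \in B -> u = v.
Proof.
move=> AE BE AB uA uB vA vB; have /card_le1_eqP := hlin AE BE AB; apply.
  by rewrite inE vA.
by rewrite inE uA.
Qed.

Lemma part_inj A : A \in E -> {in A &, injective c}.
Proof.
move=> AE u v uA vA cuv; have /eqP/cards1P[w wE] := hpart AE (c u).
have : u \in [set w] by rewrite -wE inE uA eqxx.
have : v \in [set w] by rewrite -wE inE vA cuv eqxx.
by rewrite !inE => /eqP-> /eqP->.
Qed.

Lemma rainbow_cycle_tuple k (v : k.-tuple V) (A : k.-tuple {set V}) :
  uniq (map c v) -> uniq A -> {subset A <= E} ->
  (forall i, tnth v i \in tnth A i /\ tnth v (ordS i) \in tnth A i) ->
  has_rainbow_cycle E c k.
Proof.
move=> ucv uA AE inc; have cv_inj : injective (fun i => c (tnth v i)).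
  have /tuple_uniqP inj : uniq (map_tuple c v) by [].
  by move=> i j cij; apply: inj; rewrite !tnth_map.
exists (tnth v), (tnth A); split=> //; split=> //.
- by move=> i j vij; apply: cv_inj; rewrite /= vij.
- exact/tuple_uniqP.
- by move=> i; apply/AE/mem_tnth.
Qed.

Hypothesis h3 : ~ has_rainbow_cycle E c 3.
Hypothesis h4 : ~ has_rainbow_cycle E c 4.

(** If p and q differ, linearity makes p, q, s distinct. Any two of them share an edge, so they lie
    in different parts: a 3-cycle is automatically rainbow. *)
Lemma no_triangle A B D p q s :
  A \in E -> B \in E -> D \in E -> A != B -> B != D -> D != A ->
  p \in A -> p \in B -> q \in B -> q \in D -> s \in D -> s \in A -> p = q.
Proof.
move=> AE BE DE AB BD DA pA pB qB qD sD sA.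
apply/eqP/negPn/negP => pq; apply: h3.
have qs : q != s.
  by apply: contra_neq pq => qs; apply: (linear_meet AE BE) => //; rewrite qs.
have ps : p != s.
  by apply: contra_neq pq => ps; apply: (linear_meet BE DE) => //; rewrite ps.
apply: (@rainbow_cycle_tuple 3 [tuple p; q; s] [tuple B; D; A]).
- rewrite /= !inE !negb_or !andbT (inj_in_eq (part_inj BE)) ?pq //=.
  by rewrite (inj_in_eq (part_inj AE)) ?ps //= (inj_in_eq (part_inj DE)).
- by rewrite /= !inE !negb_or BD DA eq_sym AB.
- by move=> X; rewrite !inE => /or3P[]/eqP->.
- by case=> [[|[|[|//]]] ?]; rewrite !(tnth_nth p) !(tnth_nth A).
Qed.

(** * The graph of links on the edges of F *)

Variable F : {set {set V}}.
Hypothesis FE : F \subset E.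

(* Junk value: root v = set0 when no edge of F contains v. *)
Definition root v := odflt set0 [pick A in F | v \in A].

Lemma rootP v : v \in cover F -> root v \in F /\ v \in root v.
Proof.
rewrite /root; case: pickP => [A /andP[] //|none] /bigcupP[A AF vA].
by have := none A; rewrite AF vA.
Qed.

Definition link v (A B : {set V}) := [&& A != B, v \in A, v \in B & root v \in [:: A; B]].

Definition star (A B : {set V}) := [exists v, link v A B].

Lemma linkC v A B : link v A B = link v B A.
Proof. by rewrite /link eq_sym !inE orbC; congr (_ && _); rewrite andbCA. Qed.

(** By [no_triangle] and linearity the three links would come from one vertex, whose root would lie
    in {A, B}, {B, D} and {A, D}; these have no common element. *)
Lemma link_triangle A B D p q s : A \in F -> B \in F -> D \in F ->
  link p A B -> link q B D -> ~~ link s A D.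
Proof.
move=> /(subsetP FE) AE /(subsetP FE) BE /(subsetP FE) DE.
move=> /and4P[AB pA pB rp] /and4P[BD qB qD rq]; apply/negP => /and4P[AD sA sD rs].
have DA : D != A by rewrite eq_sym.
have pq := no_triangle AE BE DE AB BD DA pA pB qB qD sD sA.
rewrite -pq in qD rq; have sp := linear_meet AE DE AD sA sD pA qD.
rewrite sp in rs; move: rp rq rs; rewrite !inE.
case/orP=> /eqP->; first by rewrite (negbTE AB) (negbTE AD).
by rewrite (negbTE BD) orbF eq_sym (negbTE AB) eqxx.
Qed.

(** If p = q, then A and D meet in p, and [no_triangle] for A, D, G gives p = s. The root of p lies
    in {A, B} and {B, D}, so it is B, which is not in {D, G}. *)
Lemma link_quad_neq A B D G p q s t :
  A \in F -> B \in F -> D \in F -> G \in F -> A != D -> B != G ->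
  link p A B -> link q B D -> link s D G -> link t G A -> p != q.
Proof.
move=> /(subsetP FE) AE /(subsetP FE) BE /(subsetP FE) DE /(subsetP FE) GE AD BG.
move=> /and4P[AB pA pB rp] /and4P[BD qB qD rq].
move=> /and4P[DG sD sG rs] /and4P[GA tG tA rt]; apply/eqP => pq.
rewrite -pq in qB qD rq.
have ps := no_triangle AE DE GE AD DG GA pA qD sD sG tG tA.
rewrite -ps in rs; move: rp rq rs; rewrite !inE.
case/orP=> /eqP->; first by rewrite (negbTE AB) (negbTE AD).
by rewrite (negbTE BD) (negbTE BG).
Qed.

(** Cyclically consecutive vertices are distinct and share an edge, so their parts differ. If the
    parts of both opposite pairs differed too, p, q, s, t would form a rainbow 4-cycle. *)
Lemma link_quad A B D G p q s t :
  A \in F -> B \in F -> D \in F -> G \in F -> A != D -> B != G ->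
  link p A B -> link q B D -> link s D G -> link t G A ->
  c p <> c q /\ (c p = c s \/ c q = c t).
Proof.
move=> AF BF DF GF AD BG lp lq ls lt.
have [DA GB] : D != A /\ G != B by rewrite eq_sym AD eq_sym BG.
have pq := link_quad_neq AF BF DF GF AD BG lp lq ls lt.
have qs := link_quad_neq BF DF GF AF BG DA lq ls lt lp.
have st := link_quad_neq DF GF AF BF DA GB ls lt lp lq.
have tp := link_quad_neq GF AF BF DF GB AD lt lp lq ls.
move: AF BF DF GF => /(subsetP FE) AE /(subsetP FE) BE /(subsetP FE) DE /(subsetP FE) GE.
case/and4P: lp => AB pA pB _; case/and4P: lq => BD qB qD _.
case/and4P: ls => DG sD sG _; case/and4P: lt => GA tG tA _.
have cpq : c p != c q by rewrite (inj_in_eq (part_inj BE)).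
have cqs : c q != c s by rewrite (inj_in_eq (part_inj DE)).
have cst : c s != c t by rewrite (inj_in_eq (part_inj GE)).
have cpt : c p != c t by rewrite (inj_in_eq (part_inj AE)) // eq_sym.
split; first exact/eqP.
have [|cps] := eqVneq (c p) (c s); [by left | right].
apply/eqP/negPn/negP => cqt; apply: h4.
apply: (@rainbow_cycle_tuple 4 [tuple p; q; s; t] [tuple B; D; G; A]).
- by rewrite /= !inE !negb_or cpq cps cpt cqs cqt cst.
- by rewrite /= !inE !negb_or BD BG DG DA GA eq_sym AB.
- by move=> X; rewrite !inE => /or4P[]/eqP->.
- by case=> [[|[|[|[|//]]]] ?]; rewrite !(tnth_nth p) !(tnth_nth A).
Qed.

(** Distinct edges share at most one vertex, so [pick] has no real choice for them; disjoint pairs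
    get [None]. *)
Definition edge_color (A B : {set V}) := omap c [pick v in A :&: B].

Lemma edge_colorE A B v : A \in F -> B \in F -> link v A B ->
  edge_color A B = Some (c v).
Proof.
move=> /(subsetP FE) AE /(subsetP FE) BE /and4P[AB vA vB _].
rewrite /edge_color; case: pickP => [u|/(_ v)]; last by rewrite !inE vA vB.
rewrite inE => /andP[uA uB]; congr (Some (c _)).
exact: linear_meet uA uB vA vB.
Qed.

Let T := {A | A \in F}.
Let e : rel T := fun A B => star (val A) (val B).

Lemma star_deg_lt26 : #|F| = 8 -> \sum_(A : T) #|[set B | e A B]| < 26.
Proof.
move=> F8; apply: (@sum_deg_lt26 _ _ e (fun A B => edge_color (val A) (val B))).
- by move=> A B; apply: eq_existsb => v; rewrite linkC.
- by move=> A B; rewrite /edge_color setIC.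
- move=> [A AF] [B BF] [D DF] /existsP[p lp] /existsP[q lq].
  by rewrite negb_exists; apply/forallP => s; apply: link_triangle lp lq.
- move=> [A AF] [B BF] [D DF] [G GF] /existsP[p lp] /existsP[q lq] /existsP[s ls].
  move=> /existsP[t lt] AD BG; rewrite /=.
  rewrite (edge_colorE AF BF lp) (edge_colorE BF DF lq) (edge_colorE DF GF ls).
  rewrite (edge_colorE GF AF lt).
  have [pq h] := link_quad AF BF DF GF AD BG lp lq ls lt.
  by split; [case | case: h => ->; [left | right]].
- by rewrite card_sig.
Qed.

(** Of the incidences [I], at most one per covered vertex is with its root. Each other incidence (A,
    v) links A to [root v], and the boolean gives this link its two orientations. *)
Lemma star_deg_sum :
  (\sum_(A in F) #|A| - #|cover F|).*2 <= \sum_(A : T) #|[set B | e A B]|.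
Proof.
pose I := [set x : {set V} * V | (x.1 \in F) && (x.2 \in x.1)].
pose R := [set (root v, v) | v in cover F].
have cI : #|I| = \sum_(A in F) #|A|.
  under eq_bigr do rewrite -sum1_card.
  by rewrite pair_big_dep /= -sum1_card; apply: eq_bigl => x; rewrite inE.
have cS : \sum_(A in F) #|A| - #|cover F| <= #|I :\: R|.
  have RI : #|I :&: R| <= #|cover F|.
    exact: leq_trans (subset_leq_card (subsetIr _ _)) (leq_imset_card _ _).
  by rewrite cardsD cI leq_sub2l.
have SP A v : (A, v) \in I :\: R ->
    [/\ A \in F, root v \in F, v \in A, v \in root v & A != root v].
  rewrite !inE /= => /and3P[nR AF vA].
  have vF : v \in cover F by apply/bigcupP; exists A.
  have [rF vr] := rootP vF; split=> //; apply: contraNneq nR => ->.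
  exact: imset_f.
pose f (x : ({set V} * V) * bool) :=
  if x.2 then (x.1.1, root x.1.2) else (root x.1.2, x.1.1).
(* Equal images put both u and v into A and [root u], so u = v by linearity; the orientations then
   agree because A differs from [root u]. *)
have f_inj : {in setX (I :\: R) [set: bool] &, injective f}.
  move=> [[A u] a] [[B v] b] /=; rewrite !in_setX !in_setT !andbT.
  move=> /SP[/(subsetP FE) AE /(subsetP FE) uE uA ur Au].
  move=> /SP[/(subsetP FE) BE /(subsetP FE) vE vB vr Bv].
  move=> fE; have [vA vru] : v \in A /\ v \in root u.
    by move: fE; rewrite /f; case: a; case: b => /= -[-> ->].
  have uv := linear_meet AE uE Au uA ur vA vru.
  move: fE; rewrite /f -uv; case: a; case: b => /= -[].
  - by move=> ->.
  - by move/eqP; rewrite (negbTE Au).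
  - by move=> _ /eqP; rewrite (negbTE Au).
  - by move=> ->.
pose P := [set x : T * T | e x.1 x.2].
have <- : #|P| = \sum_(A : T) #|[set B | e A B]|.
  under [RHS]eq_bigr do rewrite -sum1_card.
  rewrite pair_big_dep /= -sum1_card; apply: eq_bigl => x.
  by rewrite !inE.
apply: (@leq_trans #|f @: setX (I :\: R) [set: bool]|).
  by rewrite card_in_imset // cardsX cardsT card_bool muln2 leq_double.
pose g (x : T * T) := (val x.1, val x.2).
apply: leq_trans (leq_imset_card g P); apply/subset_leq_card/subsetP => x.
case/imsetP=> -[[A v] b]; rewrite in_setX => /andP[/SP[AF rF vA vr Ar] _] ->.
have lAr : link v A (root v) by rewrite /link Ar vA vr !inE eqxx orbT.
case: b; apply/imsetP.
  exists (exist _ A AF, exist _ (root v) rF) => //.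
  by rewrite inE; apply/existsP; exists v.
exists (exist _ (root v) rF, exist _ A AF) => //.
by rewrite inE; apply/existsP; exists v; rewrite linkC.
Qed.

End StarGraph.

Unset Implicit Arguments.

Theorem theorem16 (r : nat) (V : finType) (E : {set {set V}}) (c : V -> 'I_r)
  (hr : 3 <= r)
  (hunif : uniform E r)
  (hpart : partite E c)
  (hlin : linear_hypergraph E)
  (h3 : ~ has_rainbow_cycle E c 3)
  (h4 : ~ has_rainbow_cycle E c 4) :
  G_free E (8 * r - 13) 8.
Proof.
move=> F FE F8; have := star_deg_sum hlin FE.
have := star_deg_lt26 hpart hlin h3 h4 FE F8.
have -> : \sum_(A in F) #|A| = 8 * r.
  by rewrite -F8 -sum_nat_const; apply: eq_bigr => A /(subsetP FE) /hunif.
(* At most 8r - 13 covered vertices would leave at least 13 links, a degree sum of at least 26; [hr]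
   keeps the subtraction from truncating. *)
lia.
Qed.
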